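(* Fix integers $a\ge1$ and $q\ge0$. Put $M=\lfloor q/2\rfloor$ and $w_j=\binom{j+a-1}{a-1}$ for $0\le j\le q$. Define polynomials $\alpha_k,\beta_k,\gamma_k,\delta_k\in\mathbb Z[y]$ for $0\le k\le M$ by $$\alpha_0=y,\quad \beta_0=1,\quad \gamma_0=1,\quad \delta_0=0,$$ and, for $0\le k<M$, $$\gamma_{k+1}=\gamma_k-w_{q-k}\,y\,\alpha_k,\qquad \delta_{k+1}=\delta_k-w_{q-k}(1+y\beta_k),$$ $$\alpha_{k+1}=\alpha_k+w_{k+1}\,y\,\gamma_{k+1},\qquad \beta_{k+1}=\beta_k+w_{k+1}(1+y\delta_{k+1}).$$ If $q=2M$ is even, then $$\mathcal F_{2M}^{(a)}(y)=\frac{\beta_M-\delta_M}{\gamma_M-\alpha_M}.$$ If $q=2M+1$ is odd, then $$\mathcal F_{2M+1}^{(a)}(y)=\frac{\beta_M+w_{M+1}(1+y\beta_M)-\delta_M}{\gamma_M-\alpha_M-w_{M+1}\,y\,\alpha_M}.$$ In the even case the denominator $\gamma_M-\alpha_M$ has constant term $1$ (indeed $\gamma_M(0)=1$ and $\alpha_M(0)=0$). Moreover, in each case the displayed fraction gives, without any cancellation, the visible numerator and visible denominator: its numerator equals $P_q^{(a)}(y)$ and its denominator equals $Q_q^{(a)}(y)$.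
   Context: For integers $a,m\ge1$ let $x=(x_{i,j})_{1\le i\le m,\,1\le j\le a}\in\mathbb R^{am}$ and $R_i=x_{i,1}+\cdots+x_{i,a}$. The path block polytope is $\mathcal P_m^{(a)}=\{x\in\mathbb R_{\ge0}^{am}: R_i+R_{i+1}\le1,\ 1\le i\le m-1\}$ for $m\ge2$, and $\mathcal P_1^{(a)}=\{x\in\mathbb R_{\ge0}^{a}:R_1\le1\}$. For integers $q\ge0$, $L_m^{(a)}(q)=\#(q\mathcal P_m^{(a)}\cap\mathbb Z^{am})$, and the length generating function is the formal power series $\mathcal F_q^{(a)}(y)=\sum_{m\ge1}L_m^{(a)}(q)\,y^{m-1}$. Let $C_q^{(a)}$ be the $(q+1)\times(q+1)$ matrix indexed by $0\le r,s\le q$ with $(C_q^{(a)})_{r,s}=\binom{s+a-1}{a-1}$ if $r+s\le q$ and $0$ otherwise. The visible denominator is $Q_q^{(a)}(y)=\det(I-yC_q^{(a)})$ (so $Q_q^{(a)}(0)=1$), and the visible numerator is the polynomial $P_q^{(a)}(y)$ with $\mathcal F_q^{(a)}(y)=P_q^{(a)}(y)/Q_q^{(a)}(y)$; this fraction need not be reduced. *)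

(* Defs.v *)
From HB Require Import structures.
From mathcomp Require Import all_boot all_order all_algebra finmap.
From mathcomp Require Import classical_sets cardinality reals.

Set Implicit Arguments.
Unset Strict Implicit.
Unset Printing Implicit Defensive.

Import Order.TTheory GRing.Theory Num.Theory.
Local Open Scope classical_set_scope.
Local Open Scope ring_scope.

(* A point of R^(am) is an m x a matrix whose i-th row is the i-th block; all
   indices start at 0. *)
Definition block_sum (R : realType) (m a : nat) (x : 'M[R]_(m, a)) (i : 'I_m)
  : R := \sum_(j < a) x i j.

Definition path_block_polytope (R : realType) (a m : nat) : set 'M[R]_(m, a) :=
  [set x : 'M[R]_(m, a) | (forall i j, 0 <= x i j) /\
           (if m == 1%N then forall i : 'I_m, block_sum x i <= 1
            else forall i i' : 'I_m, i' = i.+1 :> nat ->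
                   block_sum x i + block_sum x i' <= 1)].
Arguments path_block_polytope : clear implicits.

Definition dilate (R : realType) (a m q : nat) (A : set 'M[R]_(m, a))
  : set 'M[R]_(m, a) := [set q%:R *: x | x in A].

(* For m >= 1 the polytope is bounded, so the set counted is finite and the
   default value fset0 of fset_set on infinite sets is irrelevant. *)
Definition lattice_count (R : realType) (a m q : nat) : nat :=
  #|` fset_set (dilate q (path_block_polytope R a m) `&`
                [set x : 'M[R]_(m, a) | forall i j, x i j \is a Num.int]) |.

(* A formal power series is its coefficient sequence. *)
Definition length_series (R : realType) (a q : nat) : nat -> int :=
  fun n => (lattice_count R a n.+1 q)%:Z.

(* F = N / D in K[[y]]: D is invertible there (its constant term is a unit) and
   D * F = N. *)
Definition fps_is_frac (K : comUnitRingType) (F : nat -> K) (N D : {poly K})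
  : Prop :=
  D`_0 \is a GRing.unit /\
  forall n, \sum_(i < n.+1) D`_i * F (n - i)%N = N`_n.

Definition weight (a j : nat) : int := ('C(j + a - 1, a - 1))%:Z.

Definition transfer_mx (a q : nat) : 'M[int]_(q.+1) :=
  \matrix_(r, s) (if (r + s <= q)%N then weight a s else 0).

Definition visible_denominator (a q : nat) : {poly int} :=
  \det (1%:M - 'X *: map_mx polyC (transfer_mx a q)).

Definition is_visible_numerator (R : realType) (a q : nat) (P : {poly int})
  : Prop := fps_is_frac (length_series R a q) P (visible_denominator a q).

Record abcd := Abcd {
  alpha : {poly int}; beta : {poly int}; gamma : {poly int}; delta : {poly int}
}.

(* Only meaningful for k <= q/2, where q - k' below is never truncated. *)
Fixpoint abcd_rec (a q k : nat) : abcd :=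
  if k is k'.+1 then
    let: Abcd al be ga de := abcd_rec a q k' in
    let w j := (weight a j)%:P in
    let ga' := ga - w (q - k')%N * 'X * al in
    let de' := de - w (q - k')%N * (1 + 'X * be) in
    let al' := al + w k * 'X * ga' in
    let be' := be + w k * (1 + 'X * de') in
    Abcd al' be' ga' de'
  else Abcd 'X 1 1 0.

(* Main.v *)
Require Import Defs.
From HB Require Import structures.
From mathcomp Require Import all_boot all_order all_algebra finmap.
From mathcomp Require Import classical_sets cardinality reals.
From mathcomp Require Import perm zify ring.

Import Order.TTheory GRing.Theory Num.Theory.
Local Open Scope ring_scope.

(** Reading the block sums one at a time, [L_m(q)] counts weighted walks: it is
    the entry [0] of [C^m 1].  Put [U_r = sum_m y^m (C^m 1)_r], so that
    [U = 1 + y C U] and [U_0 = 1 + y F].  Subtracting consecutive rows gives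
    [U_r - U_(r+1) = y w_(q-r) U_(q-r)], and solving these relations from both
    ends yields [U_k = 1 + y delta_k + y gamma_k F] and
    [U_(q-k) = 1 + y beta_k + y alpha_k F]; the two families meet in the middle,
    which determines [F].

    For the determinant, let [v] be the vector
    [(gamma_0, gamma_1, ..., alpha_1, alpha_0)].  Then [(I - y C) v] is [den]
    times a 0/1 vector, and [v_0 = 1], so [den] divides [det (I - y C)] by
    Cramer's rule.  As [den] has degree [q+1], the determinant has at most this
    degree, and both have constant term [1], they are equal. *)

(** * Rows of [I - y C] and the recurrences solved from both ends *)

(* Row [r] of [(I - y C) f]. *)
Definition resolvent_row (a q : nat) (f : nat -> {poly int}) (r : nat) :=
  f r - 'X * \sum_(s < (q - r).+1) (weight a s)%:P * f s.

(** Rows [r] and [r+1] of [C] differ only in column [q - r]. *)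
Lemma resolvent_rowB (a q : nat) (f : nat -> {poly int}) (r : nat) :
  (r < q)%N -> resolvent_row a q f r = resolvent_row a q f r.+1
    + (f r - f r.+1 - 'X * (weight a (q - r))%:P * f (q - r)%N).
Proof.
move=> rq; rewrite /resolvent_row (_ : (q - r)%N = (q - r.+1).+1); last by lia.
rewrite big_ord_recr /=; set s := \sum_(_ < _) _; ring.
Qed.

Lemma weight0 (a : nat) : weight a 0 = 1.
Proof. by rewrite /weight add0n binn. Qed.

Lemma weight_gt0 (a j : nat) : (1 <= a)%N -> 0 < weight a j.
Proof. by move=> a1; rewrite /weight ltz_nat bin_gt0; lia. Qed.

Definition fold_at (q M : nat) (A B : nat -> {poly int}) (r : nat) :=
  if (r <= M)%N then B r else A (q - r)%N.

(** Row [q] involves only the entries [q] and [0]. Going down from it, the recurrences make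
    consecutive rows agree, except at [r = M], where the two families meet; the mismatch arising
    there is inherited by all rows [r <= M]. *)
Lemma resolvent_row_fold (a q M : nat) (A B : nat -> {poly int}) :
  (forall k, (k < M)%N ->
     B k.+1 = B k - 'X * (weight a (q - k))%:P * A k) ->
  (forall k, (k < M)%N ->
     A k.+1 = A k + 'X * (weight a k.+1)%:P * B k.+1) ->
  q = (M.*2 + odd q)%N ->
  forall r, (r <= q)%N -> resolvent_row a q (fold_at q M A B) r =
    A 0%N - 'X * B 0%N + (B M - A M
      - (if odd q then 'X * (weight a M.+1)%:P * A M else 0)) *+ (r <= M)%N.
Proof.
move=> HB HA eq_q r; set d := B M - A M - _ => le_rq.
(* Downward induction on [r], run as induction on [k = q - r]. *)
rewrite -(subKn le_rq); move: (q - r)%N (leq_subr r q) => {r le_rq}.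
elim=> [_|k IHk lt_kq].
  rewrite subn0 /resolvent_row subnn big_ord1 weight0 /fold_at /= mul1r subnn.
  case: (leqP q M) => [le_qM|_]; last by rewrite mulr0n addr0.
  have [q0 M0] : q = 0%N /\ M = 0%N by lia.
  by rewrite /d q0 M0 /=; ring.
have eq_Sr : (q - k = (q - k.+1).+1)%N by lia.
rewrite resolvent_rowB -?eq_Sr; last by lia.
rewrite (IHk (ltnW lt_kq)) (_ : (q - (q - k.+1) = k.+1)%N); last by lia.
move: eq_Sr; set r := (q - k.+1)%N => eq_Sr.
rewrite -addrA; congr (_ + _); rewrite /fold_at eq_Sr subKn //.
rewrite (_ : (q - r.+1 = k)%N); last by lia.
have [lt_rM|lt_Mr|eq_rM] := ltngtP r M.
- rewrite (_ : (k.+1 <= M)%N = false); last by lia.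
  by rewrite -/r HB // (_ : (q - r = k.+1)%N); [ring|lia].
- rewrite (_ : (k.+1 <= M)%N); last by lia.
  by rewrite (HA k); [ring|lia].
(* At the junction, [q - M] is [M.+1] for odd [q], so the weight [M.+1] and [A M] remain; for even
   [q] it is [M], and the recurrence for [A] absorbs the weighted term. *)
rewrite -/r eq_rM mulr0n mulr1n add0r /d; case: (boolP (odd q)) => Oq.
  rewrite (_ : (k < M)%N = false); last by lia.
  by rewrite (_ : k = M); [ring|lia].
by rewrite (_ : M = k.+1) ?ltnSn ?HA; [ring|lia..].
Qed.

Lemma alphaS (a q k : nat) : alpha (abcd_rec a q k.+1) =
  alpha (abcd_rec a q k) + 'X * (weight a k.+1)%:P * gamma (abcd_rec a q k.+1).
Proof. by rewrite /=; case: abcd_rec => al be ga de /=; ring. Qed.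

Lemma gammaS (a q k : nat) : gamma (abcd_rec a q k.+1) =
  gamma (abcd_rec a q k) - 'X * (weight a (q - k))%:P * alpha (abcd_rec a q k).
Proof. by rewrite /=; case: abcd_rec => al be ga de /=; ring. Qed.

Lemma betaS (a q k : nat) : beta (abcd_rec a q k.+1) = beta (abcd_rec a q k)
  + (weight a k.+1)%:P * (1 + 'X * delta (abcd_rec a q k.+1)).
Proof. by rewrite /=; case: abcd_rec => al be ga de /=; ring. Qed.

Lemma deltaS (a q k : nat) : delta (abcd_rec a q k.+1) = delta (abcd_rec a q k)
  - (weight a (q - k))%:P * (1 + 'X * beta (abcd_rec a q k)).
Proof. by rewrite /=; case: abcd_rec => al be ga de /=; ring. Qed.

(** The meeting relation is [U_M = U_(q-M)] for even [q] and [U_M - U_(M+1) = y w_(M+1) U_(M+1)] for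
    odd [q]. Solving it for [F] gives [closing_num / closing_den]. *)
Definition closing_num (a q : nat) : {poly int} :=
  let c := abcd_rec a q q./2 in beta c - delta c
    + (if odd q then (weight a q./2.+1)%:P * (1 + 'X * beta c) else 0).

Definition closing_den (a q : nat) : {poly int} :=
  let c := abcd_rec a q q./2 in gamma c - alpha c
    - (if odd q then 'X * (weight a q./2.+1)%:P * alpha c else 0).

(** In these terms [U = particular_sol + y F homogeneous_sol]. *)
Definition homogeneous_sol (a q : nat) : nat -> {poly int} :=
  fold_at q q./2 (fun k => alpha (abcd_rec a q k))
                 (fun k => gamma (abcd_rec a q k)).

Definition particular_sol (a q : nat) : nat -> {poly int} :=
  fold_at q q./2 (fun k => 1 + 'X * beta (abcd_rec a q k))
                 (fun k => 1 + 'X * delta (abcd_rec a q k)).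

Lemma double_half_odd (q : nat) : q = ((q./2).*2 + odd q)%N.
Proof. by rewrite addnC odd_double_half. Qed.

Lemma resolvent_row_homogeneous (a q r : nat) : (r <= q)%N ->
  resolvent_row a q (homogeneous_sol a q) r =
    closing_den a q *+ (r <= q./2)%N.
Proof.
move=> le_rq.
rewrite (resolvent_row_fold _ _ _ _ _ _ _ (double_half_odd q)) //.
(* The common term vanishes because [alpha_0 = y gamma_0]. *)
- by rewrite /= mulr1 subrr add0r.
- by move=> k _; exact: gammaS.
- by move=> k _; exact: alphaS.
Qed.

Lemma resolvent_row_particular (a q r : nat) : (r <= q)%N ->
  resolvent_row a q (particular_sol a q) r =
    1 - 'X * closing_num a q *+ (r <= q./2)%N.
Proof.
move=> le_rq.
rewrite (resolvent_row_fold _ _ _ _ _ _ _ (double_half_odd q)) //.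
(* Here the common term is [(1 + y) - y = 1]. *)
- rewrite /= /closing_num; case: leqP => _; rewrite ?mulr0n ?mulr1n; last by ring.
  by case: odd; ring.
- by move=> k _; rewrite deltaS; ring.
- by move=> k _; rewrite betaS; ring.
Qed.

(** * The walk series as a quotient of polynomials *)

(* In [I - y C] the two 0/1 vectors cancel, so this is [den * U]. *)
Definition cleared_sol (a q r : nat) : {poly int} :=
  closing_den a q * particular_sol a q r
  + 'X * closing_num a q * homogeneous_sol a q r.

Lemma cleared_sol0 (a q : nat) :
  cleared_sol a q 0 = closing_den a q + 'X * closing_num a q.
Proof.
by rewrite /cleared_sol /particular_sol /homogeneous_sol /fold_at leq0n /=; ring.
Qed.

Lemma resolvent_row_lin (a q : nat) (c d : {poly int})
    (f g : nat -> {poly int}) (r : nat) :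
  resolvent_row a q (fun s => c * f s + d * g s) r =
    c * resolvent_row a q f r + d * resolvent_row a q g r.
Proof.
rewrite /resolvent_row (eq_bigr (fun s : 'I_(q - r).+1 =>
  c * ((weight a s)%:P * f s) + d * ((weight a s)%:P * g s))).
  rewrite big_split -!mulr_sumr /=.
  by set S1 := \sum_(_ < _) _; set S2 := \sum_(_ < _) _; ring.
by move=> s _; ring.
Qed.

Lemma cleared_solE (a q r : nat) : (r <= q)%N ->
  cleared_sol a q r = closing_den a q
    + 'X * \sum_(s < (q - r).+1) (weight a s)%:P * cleared_sol a q s.
Proof.
move=> le_rq; apply/eqP; rewrite -subr_eq; apply/eqP.
rewrite -[LHS]/(resolvent_row a q (cleared_sol a q) r).
rewrite /cleared_sol resolvent_row_lin resolvent_row_homogeneous //.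
by rewrite resolvent_row_particular //; case: leqP => _; rewrite /= ?mulr0n; ring.
Qed.

(* Entry [r] of the vector [C^m 1]. *)
Fixpoint walk_count (a q m r : nat) : nat :=
  if m is m'.+1 then
    \sum_(s < (q - r).+1) 'C(s + a - 1, a - 1) * walk_count a q m' s
  else 1.

(** Because of the factor ['X], [cleared_solE] determines the coefficients of degree [n+1] from
    those of degree [n]; the convolution of [closing_den] with the walk counts obeys the same
    recursion. *)
Lemma coef_cleared_sol (a q n r : nat) : (r <= q)%N ->
  (cleared_sol a q r)`_n =
    \sum_(i < n.+1) (closing_den a q)`_i * (walk_count a q (n - i) r)%:Z.
Proof.
elim: n r => [|n IHn] r le_rq; rewrite cleared_solE // coefD coefXM /=.
  by rewrite big_ord1 /= mulr1 addr0.
rewrite [RHS]big_ord_recr /= subnn mulr1 addrC; congr (_ + _).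
rewrite coef_sum.
rewrite (eq_bigr (fun s : 'I_(q - r).+1 => \sum_(i < n.+1) weight a s *
    ((closing_den a q)`_i * (walk_count a q (n - i) s)%:Z))); last first.
  by move=> s _; rewrite coefCM IHn ?mulr_sumr //; have := ltn_ord s; lia.
rewrite exchange_big /=; apply: eq_bigr => i _.
rewrite subSn; last by rewrite -ltnS.
rewrite /= -natz natr_sum mulr_sumr; apply: eq_bigr => s _.
by rewrite natz PoszM /weight mulrCA.
Qed.

(** Entry [0] in degree [n+1]: the last term of the convolution is a coefficient of [closing_den]
    and cancels the one in [cleared_sol0], after which ['X] is divided out. *)
Lemma closing_frac (a q n : nat) :
  \sum_(i < n.+1) (closing_den a q)`_i * (walk_count a q (n - i).+1 0)%:Z
    = (closing_num a q)`_n.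
Proof.
have := coef_cleared_sol a q n.+1 0 (leq0n q).
rewrite cleared_sol0 coefD coefXM /= big_ord_recr /= subnn mulr1 addrC.
by move=> /addrI ->; apply: eq_bigr => i _; rewrite subSn // -ltnS.
Qed.

(** * Degrees, constant terms and the determinant *)

Lemma size_mulX_weight (a j : nat) (p : {poly int}) : (1 <= a)%N -> p != 0 ->
  size ('X * (weight a j)%:P * p) = (size p).+1.
Proof.
move=> a1 p0; have w0 : weight a j != 0 by rewrite gt_eqF // weight_gt0.
rewrite -mulrA mul_polyC mulrC size_mulX ?size_scale //.
by rewrite -size_poly_eq0 size_scale // size_poly_eq0.
Qed.

(** Every update adds a term of strictly larger degree than the old polynomial, as the weights are
    nonzero, so leading terms never cancel. *)
Lemma size_alpha_gamma (a q k : nat) : (1 <= a)%N ->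
  size (alpha (abcd_rec a q k)) = k.*2.+2 /\
  size (gamma (abcd_rec a q k)) = k.*2.+1.
Proof.
move=> a1; elim: k => [|k [IHa IHg]]; first by rewrite size_polyX size_poly1.
have sg : size (gamma (abcd_rec a q k.+1)) = k.*2.+3.
  have sXa : size (- ('X * (weight a (q - k))%:P * alpha (abcd_rec a q k))) =
      k.*2.+3 by rewrite size_polyN size_mulX_weight -?size_poly_eq0 ?IHa.
  by rewrite gammaS addrC size_polyDl sXa ?IHg.
have sXg : size ('X * (weight a k.+1)%:P * gamma (abcd_rec a q k.+1)) =
    k.*2.+4 by rewrite size_mulX_weight -?size_poly_eq0 ?sg.
by rewrite sg alphaS addrC size_polyDl sXg ?IHa ?doubleS.
Qed.

Lemma size_closing_den (a q : nat) : (1 <= a)%N ->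
  size (closing_den a q) = q.+2.
Proof.
move=> a1; have [sa sg] := size_alpha_gamma a q q./2 a1.
have sag : size (gamma (abcd_rec a q q./2) - alpha (abcd_rec a q q./2)) =
    (q./2).*2.+2.
  by rewrite addrC size_polyDl size_polyN sa ?sg.
have a0 : alpha (abcd_rec a q q./2) != 0 by rewrite -size_poly_eq0 sa.
rewrite /closing_den; case: (boolP (odd q)) => Oq; last by rewrite subr0 sag; lia.
set p := 'X * _ * _; have sp : size (- p) = (q./2).*2.+3.
  by rewrite size_polyN size_mulX_weight ?sa.
by rewrite addrC size_polyDl sp ?sag //; lia.
Qed.

Lemma horner0_alpha_gamma (a q k : nat) :
  (alpha (abcd_rec a q k)).[0] = 0 /\ (gamma (abcd_rec a q k)).[0] = 1.
Proof.
elim: k => [|k [IHa IHg]]; first by rewrite hornerX hornerC.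
have g1 : (gamma (abcd_rec a q k.+1)).[0] = 1.
  by rewrite gammaS !hornerE ?IHg ?IHa ?mul0r ?subr0.
by rewrite g1 alphaS !hornerE ?IHa ?mul0r ?addr0.
Qed.

Lemma horner0_closing_den (a q : nat) : (closing_den a q).[0] = 1.
Proof.
have [a0 g1] := horner0_alpha_gamma a q q./2.
by rewrite /closing_den; case: odd; rewrite !hornerE ?a0 ?g1 ?mul0r ?mulr0 ?subr0.
Qed.

Lemma size_det_leq (n : nat) (A : 'M[{poly int}]_n) :
  (forall i j, (size (A i j) <= 2)%N) -> (size (\det A) <= n.+1)%N.
Proof.
move=> sA; apply: leq_trans (size_sum _ _ _) _; apply/bigmax_leqP => s _.
rewrite mulr_sign.
have: (size (\prod_i A i (s i))%R <= n.+1)%N.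
  apply: leq_trans (size_poly_prod_leq _ _) _.
  have le_s : (\sum_i size (A i (s i)) <= n * 2)%N.
    rewrite -[X in (_ <= X * 2)%N]card_ord -sum_nat_const.
    by apply: leq_sum => i _; exact: sA.
  by rewrite cardT size_enum_ord; lia.
by case: (odd_perm s); rewrite ?size_polyN.
Qed.

Lemma visible_denominatorE (a q : nat) : (1 <= a)%N ->
  visible_denominator a q = closing_den a q.
Proof.
move=> a1; set c := closing_den a q.
pose D : 'M[{poly int}]_q.+1 := 1%:M - 'X *: map_mx polyC (transfer_mx a q).
have rowD f (i : 'I_q.+1) :
    (D *m \col_s f (s : nat)) i 0 = resolvent_row a q f i.
  rewrite /resolvent_row mulmxBl mul1mx -scalemxAl !mxE; congr (_ - _ * _).
  rewrite (big_ord_widen q.+1 (fun s => (weight a s)%:P * f s)); last first.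
    by have := ltn_ord i; lia.
  rewrite [RHS]big_mkcond; apply: eq_bigr => s _; rewrite !mxE.
  rewrite (_ : (s < (q - i).+1)%N = (i + s <= q)%N); last first.
    by have := ltn_ord i; lia.
  by case: leqP => _; rewrite ?mul0r.
have Dv : D *m \col_s homogeneous_sol a q s =
    c *: \col_(s < q.+1) (1 *+ (s <= q./2)%N).
  apply/matrixP => i j; have le_iq : (i <= q)%N by rewrite -ltnS.
  rewrite ord1 rowD resolvent_row_homogeneous //.
  by rewrite [RHS]mxE mxE mulrnAr mulr1.
(* Cramer's rule read at entry [0], where the homogeneous vector equals [gamma_0 = 1]: the cofactor
   [g] is the quotient of the determinant by [c]. *)
pose g := (\adj D *m \col_(s < q.+1) (1 *+ (s <= q./2)%N)) 0 0 : {poly int}.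
have Qcg : visible_denominator a q = c * g.
  have /matrixP/(_ 0 0) := congr1 (mulmx (\adj D)) Dv.
  rewrite mulmxA mul_adj_mx mul_scalar_mx -scalemxAr !mxE /= mulr1.
  by rewrite /g mxE.
have Q0 : (visible_denominator a q).[0] = 1.
  rewrite -horner_evalE -det_map_mx (_ : map_mx _ _ = 1%:M) ?det1 //.
  apply/matrixP => i j; rewrite !mxE rmorphB rmorphM rmorph_nat /=.
  by rewrite /horner_eval hornerX mul0r subr0.
have sQ : (size (visible_denominator a q) <= q.+2)%N.
  apply: size_det_leq => i j; rewrite !mxE.
  apply: leq_trans (size_polyD _ _) _.
  rewrite geq_max -polyCMn (leq_trans (size_polyC_leq1 _)) // size_polyN.
  by rewrite mulrC mul_polyC (leq_trans (size_scale_leq _ _)) // size_polyX.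
have Q_neq0 : visible_denominator a q != 0.
  by apply: contra_eq_neq Q0 => ->; rewrite horner0 eq_sym oner_eq0.
(* Degrees add over [int], and [c] already has the maximal degree [q+1]; hence [g] is constant, and
   evaluation at [0] gives [1]. *)
have: (size g <= 1)%N.
  move: sQ Q_neq0; rewrite Qcg mulf_eq0 negb_or => + /andP[c0 g0].
  by rewrite size_mul // size_closing_den // addSn /= -[in X in (_ <= X)%N -> _]addn1 leq_add2l.
move=> /size1_polyC eq_g; move: Q0.
rewrite Qcg eq_g hornerM hornerC horner0_closing_den mul1r => ->.
by rewrite polyC1 mulr1.
Qed.

(** * Counting sequences of blocks as walks *)

Definition row_sum (a q : nat) (u : a.-tuple 'I_q.+1) : nat :=
  \sum_(i <- u) (i : nat).

(** Stars and bars for entries bounded by [s]; relaxing the bound to [q] adds no tuple, since no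
    entry exceeds the total. *)
Lemma card_row_sum (a q s : nat) : (1 <= a)%N -> (s <= q)%N ->
  #|[set u : a.-tuple 'I_q.+1 | row_sum a q u == s]| = 'C(s + a - 1, a - 1).
Proof.
case: a => // a _ le_sq; rewrite addnS subn1 /= subn1 /= addnC.
rewrite -card_ord_partitions.
have le_sq1 : (s.+1 <= q.+1)%N by [].
pose f (t : a.+1.-tuple 'I_s.+1) := map_tuple (widen_ord le_sq1) t.
have f_inj : injective f.
  move=> t t' /(congr1 val) /= /inj_map eqtt; apply/val_inj/eqtt.
  by move=> i j /(congr1 val) /= /val_inj.
rewrite -(card_imset _ f_inj); apply: eq_card => u; rewrite inE.
apply/eqP/imsetP => [su|[t]]; last first.
  by rewrite inE => /eqP st ->; rewrite /row_sum big_map.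
have le_us x : x \in tval u -> (x <= s)%N.
  by move=> ux; rewrite -su /row_sum (big_rem x) //= leq_addr.
exists (map_tuple (fun i : 'I_q.+1 => inord i) u).
  rewrite inE big_map -[X in _ == X]su /row_sum big_seq [X in _ == X]big_seq.
  by apply/eqP/eq_bigr => x ux; rewrite inordK // ltnS le_us.
apply: val_inj => /=; rewrite -map_comp -[LHS]map_id; apply/eq_in_map => x ux.
by apply: val_inj; rewrite /= inordK // ltnS le_us.
Qed.

(** The start [r] acts as the sum of a preceding block, which lets the induction peel off the first
    block. For [r = 0] it only asks that the first sum be at most [q]. *)
Definition admissible (a q m r : nat) (t : m.-tuple (a.-tuple 'I_q.+1)) : bool :=
  path (fun x y => x + y <= q)%N r (map (row_sum a q) t).

Lemma sum_tupleS (T : finType) (m : nat) (F : m.+1.-tuple T -> nat) :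
  (\sum_t F t = \sum_(x : T) \sum_(t : m.-tuple T) F [tuple of x :: t])%N.
Proof.
rewrite pair_big /= (reindex (fun p : T * m.-tuple T => [tuple of p.1 :: p.2])) //.
exists (fun t => (thead t, [tuple of behead t])) => [[x t] _|t _] /=.
  by congr (_, _); apply: val_inj.
by rewrite [RHS]tuple_eta; apply: val_inj.
Qed.

Lemma card_admissible (a q m r : nat) : (1 <= a)%N -> (r <= q)%N ->
  #|[set t | admissible a q m r t]| = walk_count a q m r.
Proof.
move=> a1; elim: m r => [|m IHm] r le_rq.
  rewrite -[RHS](expn0 #|{: a.-tuple 'I_q.+1}|) -(card_tuple 0) -cardsT.
  by apply: eq_card => t; rewrite !inE tuple0.
rewrite -sum1dep_card big_mkcond sum_tupleS /=.
transitivity (\sum_(x : a.-tuple 'I_q.+1 | (row_sum a q x < (q - r).+1)%N)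
    walk_count a q m (row_sum a q x))%N.
  rewrite [RHS]big_mkcond; apply: eq_bigr => x _.
  rewrite /admissible /= -big_mkcond.
  rewrite ltnS leq_subRL //; case: leqP => xr.
    rewrite sum1dep_card -IHm; last by lia.
    by apply: eq_card => t; rewrite !inE.
  by rewrite big_pred0.
(* Group the first blocks by their sum [s]; each group has [weight a s] members. *)
rewrite (partition_big (fun x => inord (row_sum a q x) : 'I_(q - r).+1) xpredT) //=.
apply: eq_bigr => s _; have le_s : (s <= q)%N by have := ltn_ord s; lia.
rewrite -(card_row_sum a q s) // -sum1dep_card big_distrl /=.
apply: eq_big => [x|x]; last by move=> /andP[lt_x /eqP <-]; rewrite mul1n inordK.
apply/andP/eqP => [[lt_x /eqP <-]|xs]; first by rewrite inordK.
by rewrite xs; split=> //; apply/eqP/val_inj; rewrite /= inordK.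
Qed.

(** * Lattice points of the dilated polytope *)

(** Imposing both kinds of bounds treats one block and several blocks alike: with one block there
    are no neighbours, and with several the single bounds follow from nonnegativity. *)
Lemma dilate_path_block_polytope (R : realType) (a q m : nat)
    (x : 'M[R]_(m.+1, a)) :
  dilate q (path_block_polytope R a m.+1) x <->
  [/\ forall i j, 0 <= x i j,
      forall i, block_sum x i <= q%:R
    & forall i i' : 'I_m.+1, i' = i.+1 :> nat ->
        block_sum x i + block_sum x i' <= q%:R].
Proof.
have sumZ c (z : 'M[R]_(m.+1, a)) i : block_sum (c *: z) i = c * block_sum z i.
  by rewrite /block_sum mulr_sumr; apply: eq_bigr => j _; rewrite mxE.
have sum_ge0 (z : 'M[R]_(m.+1, a)) :
    (forall i j, 0 <= z i j) -> forall i, 0 <= block_sum z i.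
  by move=> z0 i; apply: sumr_ge0.
split=> [[z [z0 zP] <-]|[x0 xq xqq]].
  have q0 : 0 <= q%:R :> R by rewrite ler0n.
  have z1 (i i' : 'I_m.+1) : i' = i.+1 :> nat -> block_sum z i + block_sum z i' <= 1.
    move: zP; case: eqP => [[m0]|_] zP; last exact: zP.
    by move=> ii'; have := ltn_ord i'; lia.
  have z1' i : block_sum z i <= 1.
    move: zP; case: eqP => [_|m0 _] //.
    (* Compare with the next block, or with the previous one if [i] is last. *)
    have [lt_im|ge_im] := ltnP i m.
      have := z1 i (Ordinal (lt_im : (i.+1 < m.+1)%N)) erefl; apply: le_trans.
      by rewrite lerDl sum_ge0.
    have lt_im := ltn_ord i.
    have lt_i' : (i.-1 < m.+1)%N by lia.
    apply: le_trans (z1 (Ordinal lt_i') i _) => /=; last by lia.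
    by rewrite lerDr sum_ge0.
  split=> [i j|i|i i' ii']; rewrite ?mxE ?sumZ.
  - by rewrite mulr_ge0.
  - by rewrite -[leRHS]mulr1 ler_wpM2l.
  - by rewrite -mulrDr -[leRHS]mulr1 ler_wpM2l ?z1.
(* For [q = 0] one cannot rescale by the inverse; the bounds force [x = 0], the image of the
   origin. *)
have [q0|q_gt0] := posnP q.
  exists 0; last first.
    rewrite scaler0; apply/matrixP => i j; rewrite mxE; apply/esym/eqP.
    rewrite eq_le x0 andbT; apply: le_trans (_ : block_sum x i <= 0).
      by rewrite /block_sum (bigD1 j) //= lerDl sumr_ge0.
    by have := xq i; rewrite q0.
  have s0 i : block_sum (0 : 'M[R]_(m.+1, a)) i = 0.
    by rewrite /block_sum big1 // => j _; rewrite mxE.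
  by split=> [i j|]; [rewrite mxE|case: eqP => _ *; rewrite !s0 ?addr0 ler01].
have q0 : 0 < q%:R :> R by rewrite ltr0n.
exists (q%:R^-1 *: x); last by rewrite scalerA divff ?scale1r // gt_eqF.
split=> [i j|]; first by rewrite mxE mulr_ge0 // invr_ge0 ltW.
case: eqP => _ => [i|i i' ii']; rewrite !sumZ -?mulrDr mulrC ler_pdivrMr // mul1r //.
exact: xqq.
Qed.

Definition lattice_point (R : realType) (a q m : nat)
    (t : m.-tuple (a.-tuple 'I_q.+1)) : 'M[R]_(m, a) :=
  \matrix_(i, j) (tnth (tnth t i) j : nat)%:R.

Lemma lattice_point_inj (R : realType) (a q m : nat) :
  injective (@lattice_point R a q m).
Proof.
move=> t t' /matrixP eqtt; apply: eq_from_tnth => i; apply: eq_from_tnth => j.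
by apply/val_inj/eqP; have := eqtt i j; rewrite !mxE => /eqP; rewrite eqr_nat.
Qed.

Lemma block_sum_lattice_point (R : realType) (a q m : nat) t i :
  block_sum (lattice_point R a q m t) i = (row_sum a q (tnth t i))%:R.
Proof.
rewrite /block_sum /row_sum big_tuple natr_sum.
by apply: eq_bigr => j _; rewrite mxE.
Qed.

Lemma admissibleP (a q m : nat) (t : m.+1.-tuple (a.-tuple 'I_q.+1)) :
  reflect ((forall i, (row_sum a q (tnth t i) <= q)%N) /\
           (forall i i' : 'I_m.+1, i' = i.+1 :> nat ->
              (row_sum a q (tnth t i) + row_sum a q (tnth t i') <= q)%N))
          (admissible a q m.+1 0 t).
Proof.
have nthE (i : 'I_m.+1) :
    nth 0%N (map (row_sum a q) t) i = row_sum a q (tnth t i).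
  rewrite (nth_map (tnth t i)) ?size_tuple //; congr (row_sum _ _ _).
  exact/esym/tnth_nth.
apply: (iffP (pathP 0%N)); rewrite size_map size_tuple.
  move=> step.
  have stepS (i i' : 'I_m.+1) : i' = i.+1 :> nat ->
      (row_sum a q (tnth t i) + row_sum a q (tnth t i') <= q)%N.
    move=> ii'; have := step i' (ltn_ord i').
    by rewrite !nthE ii' /= nthE.
  (* Each step of the path bounds its second member, since the first is nonnegative; the initial [0]
     covers the first block. *)
  split=> // i; have := step i (ltn_ord i); rewrite nthE.
  by case: (nat_of_ord i) => [|k] /=; lia.
move=> [le1 le2] [|k] lt_k /=.
  by have := le1 ord0; rewrite -nthE.
have := le2 (Ordinal (ltnW lt_k)) (Ordinal lt_k) erefl.
by rewrite -!nthE.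
Qed.

Lemma lattice_countE (R : realType) (a q m : nat) : (1 <= a)%N ->
  lattice_count R a m.+1 q = walk_count a q m.+1 0.
Proof.
move=> a1; rewrite -card_admissible // /lattice_count.
set A := [set t | _]; pose f := lattice_point R a q m.+1.
rewrite (_ : (_ `&` _)%classic = [set` [fset f t | t in A]%fset]%classic).
  rewrite set_fsetK card_imfset; last exact: lattice_point_inj.
  by rewrite /= cardE.
apply/seteqP; split=> [x [/dilate_path_block_polytope[x0 xq xqq] xint]|x] /=.
  (* A coordinate is at most its block sum, hence at most [q], so an integral point has all its
     entries in ['I_q.+1]. *)
  have /fin_all_exists[n xn] (p : 'I_m.+1 * 'I_a) :
      exists n : 'I_q.+1, x p.1 p.2 = (n : nat)%:R.
    have /natrP[n xn] : x p.1 p.2 \is a Num.nat by rewrite natrEint xint x0.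
    have lt_n : (n < q.+1)%N.
      rewrite ltnS -(ler_nat R) -xn; apply: le_trans (xq p.1).
      by rewrite /block_sum (bigD1 p.2) //= lerDl sumr_ge0.
    by exists (Ordinal lt_n).
  pose t := [tuple [tuple n (i, j) | j < a] | i < m.+1].
  have xt : x = f t.
    by apply/matrixP => i j; rewrite !mxE !tnth_mktuple -(xn (i, j)).
  rewrite xt; apply/imfsetP; exists t => //=; rewrite inE; apply/admissibleP.
  split=> [i|i i' ii']; rewrite -(ler_nat R) ?natrD -!block_sum_lattice_point.
    by rewrite -/f -xt xq.
  by rewrite -/f -xt xqq.
case/imfsetP => t /=; rewrite inE => /admissibleP[tq tqq] ->.
split; last by move=> i j; rewrite mxE natr_int.
apply/dilate_path_block_polytope; split=> [i j|i|i i' ii'].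
- by rewrite mxE ler0n.
- by rewrite block_sum_lattice_point ler_nat tq.
- by rewrite !block_sum_lattice_point -natrD ler_nat tqq.
Qed.

Theorem theorem1p2 (R : realType) (a q : nat) (ha : (1 <= a)%N) :
  let M := (q %/ 2)%N in
  let al := alpha (abcd_rec a q M) in
  let be := beta (abcd_rec a q M) in
  let ga := gamma (abcd_rec a q M) in
  let de := delta (abcd_rec a q M) in
  let w := (weight a M.+1)%:P in
  let even_num := be - de in
  let even_den := ga - al in
  let odd_num := be + w * (1 + 'X * be) - de in
  let odd_den := ga - al - w * 'X * al in
  (q = (2 * M)%N ->
     [/\ fps_is_frac (length_series R a q) even_num even_den,
         [/\ even_den.[0] = 1, ga.[0] = 1 & al.[0] = 0],
         forall P : {poly int}, is_visible_numerator R a q P <-> P = even_num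
       & visible_denominator a q = even_den]) /\
  (q = (2 * M).+1 ->
     [/\ fps_is_frac (length_series R a q) odd_num odd_den,
         forall P : {poly int}, is_visible_numerator R a q P <-> P = odd_num
       & visible_denominator a q = odd_den]).
Proof.
move=> M al be ga de w even_num even_den odd_num odd_den.
have frac : fps_is_frac (length_series R a q) (closing_num a q) (closing_den a q).
  split=> [|n]; first by rewrite -horner_coef0 horner0_closing_den unitr1.
  rewrite -closing_frac; apply: eq_bigr => i _.
  by rewrite /length_series lattice_countE.
have denE := visible_denominatorE a q ha.
have numP (P : {poly int}) :
    is_visible_numerator R a q P <-> P = closing_num a q.
  (* Once the denominator is fixed, the convolution determines every coefficient of the
     numerator. *)
  rewrite /is_visible_numerator denE; split=> [[_ HP]|-> //].
  by apply/polyP => n; rewrite -HP; case: frac.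
have [al0 ga1] := horner0_alpha_gamma a q M.
have M_half : q./2 = M by rewrite /M divn2.
split=> [q_even|q_odd].
  have Oq : odd q = false by rewrite q_even oddM.
  have eq_num : closing_num a q = even_num.
    by rewrite /closing_num Oq M_half addr0.
  have eq_den : closing_den a q = even_den.
    by rewrite /closing_den Oq M_half subr0.
  rewrite -eq_num -eq_den; split=> //; split=> //.
  exact: horner0_closing_den.
have Oq : odd q by rewrite q_odd /= oddM.
have eq_num : closing_num a q = odd_num.
  by rewrite /closing_num Oq M_half addrAC.
have eq_den : closing_den a q = odd_den.
  by rewrite /closing_den Oq M_half (mulrC 'X).
by rewrite -eq_num -eq_den.
Qed.
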